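(* Let $\mathbb F_q$ be a finite field of characteristic $p$, let $f\in\mathbb F_q[x]$ be a nonzero polynomial, and let $n=p^t u$ with $p\nmid u$. Set $h(x)=\gcd(f(x),x^u-1)$ and $S_f(x)=(x^u-1)/h(x)$. Then the functional graph of the map $c\mapsto L_f(c)$ on $\mathbb F_{q^n}$ is $$\mathcal G(L_f/\mathbb F_{q^n})\cong\bigoplus_{g\mid S_f^{p^t}}\frac{\Phi_q(g)}{\mathcal O(f,g)}\times\mathrm{Cyc}\left(\mathcal O(f,g),\,T_{h^{p^t}(f)}\right),$$ where $g$ runs over the monic divisors of $S_f^{p^t}$ in $\mathbb F_q[x]$ and $T_{h^{p^t}(f)}$ is the elementary tree of the $\nu$-series associated with $h^{p^t}$ and $f$.
   Context: For $f=\sum a_ix^i\in\mathbb F_q[x]$, $L_f(x)=\sum a_ix^{q^i}$. For a nonconstant $g\in\mathbb F_q[x]$, $\Phi_q(g)$ is the number of units of $\mathbb F_q[x]/\langle g\rangle$, and $\Phi_q(1)=1$. For coprime $f,g$, $\mathcal O(f,g)$ is the least positive integer $k$ with $f^k\equiv1\pmod g$. The functional graph of a map has edges $x\to$ image of $x$; $\bigoplus$ is disjoint union, $k\times G$ is $k$ disjoint copies of $G$, $\bullet$ is the one-vertex tree, $\mathrm{Cyc}(m,T)$ is a directed cycle of length $m$ each vertex of which is the root of a copy of the rooted tree $T$, and $\langle T_1\oplus\cdots\oplus T_k\rangle$ is the rooted tree whose root has exactly $k$ predecessors, the $i$-th being the root of a copy of $T_i$. $\nu$-series of a nonzero polynomial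 $N_0$ (all of whose irreducible factors divide $f$) with respect to $f$: $A_1=\gcd(N_0,f)$, $A_{i+1}=\gcd(N_0/(A_1\cdots A_i),f)$, $d$ least with $A_1\cdots A_d=N_0$ (up to units), and $N_0(f)=(q^{\deg A_1},\dots,q^{\deg A_d})$. Elementary tree: for non-increasing positive $V=(\nu_1,\dots,\nu_d)$, $T^0_V=\bullet$, $T^k_V=\langle\nu_k\times T^{k-1}_V\oplus\bigoplus_{i=1}^{k-1}(\nu_i-\nu_{i+1})\times T^{i-1}_V\rangle$ for $1\le k<d$, and $T_V=\langle(\nu_d-1)\times T^{d-1}_V\oplus\bigoplus_{i=1}^{d-1}(\nu_i-\nu_{i+1})\times T^{i-1}_V\rangle$. *)

(* Defs.v *)
From HB Require Import structures.
From mathcomp Require Import all_boot all_order all_algebra all_field.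
From mathcomp Require Import boolp.

Set Implicit Arguments.
Unset Strict Implicit.
Unset Printing Implicit Defensive.

Import GRing.Theory.
Local Open Scope ring_scope.

(* The least natural number satisfying P; 0 if there is none. *)
Definition least (P : pred nat) : nat :=
  if pselect (exists k, P k) is left exP then ex_minn exP else 0%N.

Lemma leastP (P : pred nat) :
  (exists k, P k) -> P (least P) /\ (forall k, P k -> (least P <= k)%N).
Proof.
by rewrite /least; case: pselect => // exP _; case: ex_minnP => k Pk kmin.
Qed.

Record digraph := Digraph { vertex :> Type; arc : vertex -> vertex -> Prop }.
Arguments Digraph : clear implicits.

Definition digraph_iso (G H : digraph) : Prop :=
  exists phi : G -> H,
    bijective phi /\ forall x y, arc x y <-> arc (phi x) (phi y).

Definition functional_graph (V : Type) (phi : V -> V) : digraph :=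
  Digraph V (fun x y => phi x = y).

Definition dsum (I : Type) (G : I -> digraph) : digraph :=
  Digraph {i : I & G i} (fun u v =>
    exists (i : I) (x y : G i),
      [/\ u = existT _ i x, v = existT _ i y & arc x y]).

Definition copies (k : nat) (G : digraph) : digraph :=
  dsum (fun _ : 'I_k => G).

(* A rooted tree is a digraph whose arcs go from each non-root vertex to its
   parent, so that predecessors in the digraph are children in the tree. *)
Record rooted := Rooted { rgraph :> digraph; root : rgraph }.
Arguments Rooted : clear implicits.

Definition bullet : rooted := Rooted (Digraph unit (fun _ _ => False)) tt.

(* <T_1 (+) ... (+) T_k> : the vertex None is the new root. *)
Definition graft (ts : seq rooted) : rooted :=
  let D := dsum (fun i : 'I_(size ts) => nth bullet ts i : digraph) in
  Rooted (Digraph (option D) (fun u v =>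
    match u, v with
    | Some x, Some y => arc x y
    | Some x, None => projT2 x = root (nth bullet ts (projT1 x))
    | None, _ => False
    end)) None.

(* For m = 1 the cycle is a loop. *)
Definition Cyc (m : nat) (T : rooted) : digraph :=
  Digraph ('I_m * T) (fun u v =>
    (u.1 = v.1 /\ arc u.2 v.2) \/
    [/\ v.1 = ordS u.1, u.2 = root T & v.2 = root T]).

Section ElementaryTree.
Variable V : seq nat.

Local Notation nu i := (nth 0%N V i.-1).

(* The sequence T^0_V, ..., T^k_V. *)
Fixpoint subtrees (k : nat) : seq rooted :=
  if k is k'.+1 then
    let Ts := subtrees k' in
    rcons Ts (graft (nseq (nu k) (nth bullet Ts k') ++
      \big[cat/[::]]_(1 <= i < k)
         nseq (nu i - nu i.+1) (nth bullet Ts i.-1)))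
  else [:: bullet].

Definition subtree (k : nat) : rooted := nth bullet (subtrees k) k.

Lemma size_subtrees k : size (subtrees k) = k.+1.
Proof. by elim: k => //= k IHk; rewrite size_rcons IHk. Qed.

Lemma nth_subtrees k i :
  (i <= k)%N -> nth bullet (subtrees k) i = subtree i.
Proof.
elim: k => [|k IHk]; first by case: i.
rewrite leq_eqVlt => /predU1P[-> // | lt_ik].
by rewrite -IHk //= nth_rcons size_subtrees lt_ik.
Qed.

Lemma subtree0 : subtree 0 = bullet.
Proof. by []. Qed.

Lemma subtreeE k : (0 < k)%N ->
  subtree k = graft (nseq (nu k) (subtree k.-1) ++
    \big[cat/[::]]_(1 <= i < k) nseq (nu i - nu i.+1) (subtree i.-1)).
Proof.
case: k => // k _; rewrite {1}/subtree /= nth_rcons size_subtrees ltnn eqxx.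
rewrite nth_subtrees //; congr (graft (_ ++ _)).
rewrite !big_seq; apply: eq_bigr => i; rewrite mem_index_iota => /andP[i0 ik].
by rewrite nth_subtrees // -ltnS prednK // ltnW.
Qed.

Definition elementary_tree : rooted :=
  let d := size V in
  graft (nseq (nu d - 1) (subtree d.-1) ++
    \big[cat/[::]]_(1 <= i < d) nseq (nu i - nu i.+1) (subtree i.-1)).

End ElementaryTree.

Section Polynomials.
Variable F : finFieldType.
Implicit Types f g N : {poly F}.

Definition Lpoly f : {poly F} := \sum_(i < size f) f`_i *: 'X^(#|F| ^ i).

(* {poly %/ g} is F[x]/<g> only for g monic and nonconstant, whence the
   normalization and the case distinction. *)
Definition Phi g : nat :=
  if (size g <= 1)%N then 1%N
  else #|[pred x : {poly %/ (lead_coef g)^-1 *: g} | x \is a GRing.unit]|.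

Definition ord_mod f g : nat :=
  least (fun k => (0 < k)%N && (g %| f ^+ k - 1)).

(* The gcds A_1, ..., A_i of N with respect to f. MathComp's gcdp is a gcd up
   to a unit, which changes neither the degrees nor the test defining d. *)
Fixpoint nu_gcds N f (i : nat) : seq {poly F} :=
  if i is i'.+1 then
    let As := nu_gcds N f i' in
    rcons As (gcdp (N %/ \prod_(A <- As) A) f)
  else [::].

Definition nu_length N f : nat :=
  least (fun d => (0 < d)%N && (\prod_(A <- nu_gcds N f d) A %= N)).

(* The degree of a nonzero A is (size A).-1. *)
Definition nu_series N f : seq nat :=
  [seq (#|F| ^ (size A).-1)%N | A : {poly F} <- nu_gcds N f (nu_length N f)].

End Polynomials.

(* Main.v *)
Require Import Defs.
From HB Require Import structures.
From mathcomp Require Import all_boot all_order all_algebra all_field.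
From mathcomp Require Import boolp.

(* Through c |-> c^q the field K is an F[x]-module killed by m = x^n - 1, on
   which f acts as L_f. An operator L_e with e != 0 has at most q^(deg e)
   roots; together with |K| = q^n and |ker| |im| = |K| this forces
   |ker e| = q^(deg e) for every e dividing m. All counts below follow from
   this, without a normal basis.

   Write m = N G with N = h^(p^t) and G = S^(p^t). The images I_k of the
   iterates of L_f decrease to I_d = ker G, the periodic points, and the
   kernel of L_f in I_(i-1) has nu_i elements. A non-periodic y lying in I_k
   but not in I_(k+1) has exactly nu_i preimages in I_(i-1) for i <= k, so by
   induction on k the tree above y is T^k; for periodic y one preimage is
   periodic, which gives the tree T.

   The elements with annihilator g are permuted by L_f in cycles of length
   O(f, g). Their number is determined by the sizes |ker e| for e | g, hence is
   the same in K as in F[x]/<g>, where it is the number of units. *)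

Set Implicit Arguments.
Unset Strict Implicit.
Unset Printing Implicit Defensive.

Import GRing.Theory.
Local Open Scope ring_scope.

(* The names of Defs, hidden by poly.root and path.arc. *)
Local Notation root := Defs.root.
Local Notation arc := Defs.arc.

(** * Rooted trees hanging at the points of a functional graph *)

Section HangingTrees.
Variables (V : finType) (s : V -> V) (D : V -> nat).
Hypothesis Ds : forall v, D (s v) = (D v).-1.

(** The depths prescribe the number of steps from [v] to [y]. Hence a walk around a cycle, where [D]
    is constantly 0, does not count, and the tree above a periodic point meets its cycle in that
    point only. *)
Definition above (y v : V) := (D y <= D v)%N && (iter (D v - D y) s v == y).

(** The condition on depths excludes the predecessor of a periodic point on its cycle. *)
Definition child (y v : V) := (D v == (D y).+1) && (s v == y).

(* Since s is a function, the last clause upgrades the preservation of arcs to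
   an equivalence away from the root. *)
Definition hangs (y : V) (T : rooted) : Prop :=
  exists phi : T -> V,
    [/\ injective phi, phi (root T) = y,
        forall v, above y v <-> exists a, phi a = v,
        forall a b, arc a b -> s (phi a) = phi b
      & forall a, a = root T \/ exists b, arc a b].

Lemma depth_iter k v : D (iter k s v) = (D v - k)%N.
Proof. by elim: k => [|k IHk] /=; rewrite ?subn0 // Ds IHk subnS. Qed.

Lemma above_refl y : above y y.
Proof. by rewrite /above leqnn subnn eqxx. Qed.

(** The formula for [c] shows that [y] and [v] determine the child of [y] below [v]; the trees above
    distinct children are therefore disjoint. *)
Lemma above_child y c v : child y c -> above c v ->
  above y v /\ c = iter (D v - D y).-1 s v.
Proof.
case/andP=> /eqP Dc /eqP sc /andP[le_cv /eqP vc]; rewrite Dc in le_cv vc.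
have e : (D v - D y)%N = (D v - (D y).+1).+1 by rewrite -subSn // subSS.
by rewrite /above ltnW //= e /= vc sc.
Qed.

Lemma above_split y v : above y v -> v = y \/ exists2 c, child y c & above c v.
Proof.
case/andP; rewrite leq_eqVlt => /predU1P[-> | lt_yv] /eqP.
  by rewrite subnn; left.
have e : (D v - D y)%N = (D v - (D y).+1).+1 by rewrite -subSn // subSS.
rewrite e /= => vy; right; exists (iter (D v - (D y).+1) s v).
  by rewrite /child vy eqxx andbT depth_iter subKn.
by rewrite /above depth_iter subKn // lt_yv /=.
Qed.

Lemma hangs_bullet y : (forall v, ~~ child y v) -> hangs y bullet.
Proof.
move=> no_child; exists (fun=> y); split=> //; last by left; case: a.
  by case=> [] [].
move=> v; split=> [|[_ <-]]; last exact: above_refl.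
by case/above_split=> [-> | [c /(negP (no_child c))]] //; exists tt.
Qed.

(** The embeddings of the trees above the children are glued, the new root going to [y]. Injectivity
    holds because these trees are disjoint and all their points are deeper than [y]. *)
Lemma hangs_graft y (cs : seq V) (ts : seq rooted) :
    uniq cs -> size cs = size ts -> (forall v, (v \in cs) = child y v) ->
    (forall i, (i < size ts)%N -> hangs (nth y cs i) (nth bullet ts i)) ->
  hangs y (graft ts).
Proof.
move=> Ucs szcs csP hts.
have chi (i : 'I_(size ts)) : child y (nth y cs i).
  by rewrite -csP mem_nth // szcs.
have [phi phiP] : exists phi : forall i : 'I_(size ts), nth bullet ts i -> V,
    forall i : 'I_(size ts),
    [/\ injective (phi i), phi i (root (nth bullet ts i)) = nth y cs i,
        forall v, above (nth y cs i) v <-> exists a, phi i a = v,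
        forall a b, arc a b -> s (phi i a) = phi i b
      & forall a, a = root (nth bullet ts i) \/ exists b, arc a b].
  exists (fun i : 'I_(size ts) => projT1 (cid (hts i (ltn_ord i)))) => i.
  exact: projT2 (cid (hts i (ltn_ord i))).
have phi_above (i : 'I_(size ts)) (a : nth bullet ts i) :
    above (nth y cs i) (phi i a).
  by case: (phiP i) => _ _ /(_ (phi i a)) [_ ->] //; exists a.
pose psi (u : graft ts) : V :=
  if u is Some (existT i a) then phi i a else y.
have D_lt (i : 'I_(size ts)) (a : nth bullet ts i) : (D y < D (phi i a))%N.
  have /andP[+ _] := phi_above i a.
  by have /andP[/eqP-> _] := chi i.
exists psi; split=> //.
- move=> [[i a]|] [[j b]|] //= e; last first.
  + by have := D_lt j b; rewrite -e ltnn.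
  + by have := D_lt i a; rewrite e ltnn.
  (* The common image lies above both children, and it determines the child. *)
  have eij : i = j.
    apply/ord_inj/eqP; rewrite -(nth_uniq y _ _ Ucs) ?szcs //.
    have [_ ->] := above_child (chi i) (phi_above i a).
    by have [_ ->] := above_child (chi j) (phi_above j b); rewrite e.
  case: j / eij b e => b; case: (phiP i) => inj_phi _ _ _ _ /inj_phi-> //.
- move=> v; split=> [/above_split[-> | [c]] | [[[i a]|] /= <-]].
  + by exists None.
  + rewrite -csP => c_cs cv.
    have lt_i : (index c cs < size ts)%N by rewrite -szcs index_mem.
    pose i := Ordinal lt_i.
    case: (phiP i) => _ _ /(_ v)[+ _] _ _; rewrite nth_index //.
    by case=> // a <-; exists (Some (existT _ i a)).
  + by have [] := above_child (chi i) (phi_above i a).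
  + exact: above_refl.
- move=> [[i a]|] [[j b]|] //=.
    case=> k [x [x' [e1 e2 arcx]]].
    have [_ _ _ arc_phi _] := phiP k.
    (* An arc of the disjoint sum is given through equalities of dependent pairs; [ph] takes such a
       pair as one argument, so these equalities can be rewritten. *)
    pose ph (u : {i : 'I_(size ts) & nth bullet ts i}) :=
      phi (projT1 u) (projT2 u).
    rewrite -[phi i a]/(ph (existT _ i a)) -[phi j b]/(ph (existT _ j b)) e1 e2.
    exact: arc_phi.
  move->; have [_ -> _ _ _] := phiP i.
  by have /andP[_ /eqP] := chi i.
case=> [[i a]|]; [right | by left].
have [_ _ _ _ /(_ a)[-> | [b ab]]] := phiP i; first by exists None.
by exists (Some (existT _ i b)); exists i, a, b.
Qed.

(** When the tree above a child depends only on its rank, only the number of children of each rank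
    matters: the children can be reordered so that their ranks form the list [rs]. *)
Lemma hangs_graft_ranked y (rank : V -> nat) (tr : nat -> rooted) (rs : seq nat) :
    (forall j, count_mem j rs = #|[pred v | child y v & rank v == j]|) ->
    (forall v, child y v -> hangs v (tr (rank v))) ->
  hangs y (graft (map tr rs)).
Proof.
move=> countE hch; pose cs := enum (child y).
have perm_rs : perm_eq rs (map rank cs).
  apply/allP => j _ /=; rewrite countE count_map -size_filter.
  rewrite -(card_uniqP (filter_uniq _ (enum_uniq _))); apply/eqP/eq_card => v.
  by rewrite mem_filter mem_enum !inE andbC.
have [js perm_js rsE] := perm_iotaP 0%N perm_rs.
have js_lt j : j \in js -> (j < size cs)%N.
  by rewrite (perm_mem perm_js) mem_iota size_map.
(* The children in the order prescribed by [rs]. *)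
pose cs' := map (nth y cs) js.
have perm_cs : perm_eq cs' cs.
  rewrite -[X in perm_eq _ X](mkseq_nth y) /mkseq perm_map //.
  by rewrite size_map in perm_js.
have rsE' : rs = map rank cs'.
  rewrite rsE -map_comp; apply/eq_in_map => j /js_lt lt_j /=.
  exact: nth_map.
apply: (@hangs_graft y cs').
- by rewrite (perm_uniq perm_cs) enum_uniq.
- by rewrite size_map rsE' size_map.
- by move=> v; rewrite (perm_mem perm_cs) mem_enum.
move=> i; rewrite size_map rsE' size_map => lt_i.
rewrite (nth_map 0%N bullet) ?(size_map rank) // (nth_map y 0%N) //; apply: hch.
have := mem_nth y lt_i; rewrite (perm_mem perm_cs) mem_enum; exact.
Qed.

End HangingTrees.

(** * Iterated images of an additive map, and the trees they determine *)

Section ImageChain.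
Variables (V : finZmodType) (s : V -> V).
Hypothesis sB : {morph s : v w / v - w}.

Definition im_iter k : {set V} := [set iter k s v | v : V].

(* This is nu_(k+1). *)
Definition card_ker_im k := #|[set v in im_iter k | s v == 0]|.

Let iterB k : {morph iter k s : v w / v - w}.
Proof. by elim: k => // k IHk v w /=; rewrite IHk sB. Qed.

Lemma im_iterS k : im_iter k.+1 = s @: im_iter k.
Proof.
apply/setP=> y; apply/imsetP/imsetP=> [[v _ ->] | [_ /imsetP[v _ ->] ->]].
  by exists (iter k s v); rewrite ?imset_f.
by exists v.
Qed.

Lemma im_iterS_sub k : im_iter k.+1 \subset im_iter k.
Proof. by apply/subsetP=> _ /imsetP[v _ ->]; rewrite iterSr imset_f. Qed.

Lemma im_iter_sub i j : (i <= j)%N -> im_iter j \subset im_iter i.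
Proof.
move=> /subnKC <-; elim: (j - i)%N => [|k IHk]; first by rewrite addn0.
by rewrite addnS (subset_trans (im_iterS_sub _)).
Qed.

Lemma im_iterB k : {in im_iter k &, forall v w, v - w \in im_iter k}.
Proof. by move=> _ _ /imsetP[v _ ->] /imsetP[w _ ->]; rewrite -iterB imset_f. Qed.

(** The fibre is a coset of the kernel of [s] in the [k]-th image: translate by a preimage [w] of
    [y] in that image. *)
Lemma card_fiber_im k y : y \in im_iter k.+1 ->
  #|[set v in im_iter k | s v == y]| = card_ker_im k.
Proof.
rewrite im_iterS => /imsetP[w wk ->].
rewrite /card_ker_im -[RHS](card_imset _ (addIr w)); apply: eq_card => v.
rewrite !inE; apply/andP/imsetP=> [[vk /eqP svw] | [v']].
  exists (v - w); last by rewrite subrK.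
  by rewrite inE im_iterB //= sB svw subrr.
rewrite inE => /andP[v'k /eqP sv'] ->; rewrite -subr_eq0 -sB addrK sv' eqxx.
(* Closure is known for differences only, so [- w] is written as [w - w - w]. *)
split=> //; have <- : v' - (w - w - w) = v' + w by rewrite subrr sub0r opprK.
by rewrite !im_iterB.
Qed.

Lemma card_im_iterS k : #|im_iter k| = (card_ker_im k * #|im_iter k.+1|)%N.
Proof.
rewrite -sum1_card (partition_big_imset s) /= -im_iterS mulnC -sum_nat_const.
apply: eq_bigr => y yk; rewrite sum1dep_card -(card_fiber_im yk).
by apply: eq_card => v; rewrite !inE.
Qed.

Variable d : nat.
Hypothesis d_gt0 : (0 < d)%N.
Hypothesis im_stable : #|im_iter d.+1| = #|im_iter d|.

Let P := im_iter d.

Lemma im_iterS_stable : im_iter d.+1 = P.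
Proof. by apply/eqP; rewrite eqEcard im_iterS_sub im_stable /=. Qed.

Lemma stable_imset : s @: P = P.
Proof. by rewrite -im_iterS im_iterS_stable. Qed.

(** A surjection of the finite set [P] onto itself is injective. *)
Lemma stable_inj : {in P &, injective s}.
Proof. by apply/imset_injP; rewrite stable_imset. Qed.

Lemma stableS v : v \in P -> s v \in P.
Proof. by move=> vP; rewrite -stable_imset imset_f. Qed.

Lemma stable_iter k v : v \in P -> iter k s v \in P.
Proof. by move=> vP; elim: k => //= k; apply: stableS. Qed.

Fact depth_ex v : exists k, iter k s v \in P.
Proof. by exists d; rewrite imset_f. Qed.

Definition depth v := ex_minn (depth_ex v).

Lemma depth_leq v k : (depth v <= k)%N = (iter k s v \in P).
Proof.
rewrite /depth; case: ex_minnP => j vj jmin; apply/idP/idP; last exact: jmin.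
by move=> /subnK <-; rewrite iterD stable_iter.
Qed.

Lemma depth_eq0 v : (depth v == 0%N) = (v \in P).
Proof. by rewrite -leqn0 depth_leq. Qed.

Lemma depthS v : depth (s v) = (depth v).-1.
Proof.
apply/eqP; rewrite eqn_leq depth_leq -iterSr -depth_leq leqSpred /=.
by rewrite -subn1 leq_subLR add1n depth_leq iterSr -depth_leq.
Qed.

Lemma childE y v : child s depth y v = (v \notin P) && (s v == y).
Proof.
rewrite /child andbC [RHS]andbC; case: eqP => //= <-.
by rewrite depthS -depth_eq0; case: (depth v) => // k; rewrite eqxx.
Qed.

(** Outside [P] this is the largest [k] such that [v] lies in the [k]-th image; on [P] the search
    fails and returns [d]. *)
Definition rank v := find (fun k => v \notin im_iter k.+1) (iota 0 d).

Lemma rank_lt v : v \notin P -> (rank v < d)%N.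
Proof.
move=> vP; rewrite -[X in (_ < X)%N](size_iota 0 d) -has_find.
apply/hasP; exists d.-1; rewrite ?prednK //.
by rewrite mem_iota add0n leq0n /= ltn_predL.
Qed.

Lemma rankP v k : v \notin P -> (k <= rank v)%N = (v \in im_iter k).
Proof.
move=> vP; have r_lt := rank_lt vP; apply/idP/idP=> [|vk].
  case: k => [|k] lt_k; first by apply/imsetP; exists v.
  have := before_find 0%N lt_k; rewrite nth_iota ?(leq_trans lt_k (ltnW _)) //.
  by move/negbFE.
rewrite leqNgt; apply/negP=> lt_r.
have hasv : has (fun k => v \notin im_iter k.+1) (iota 0 d).
  by rewrite has_find size_iota.
have := nth_find 0%N hasv; rewrite nth_iota // add0n => /negP[].
exact: subsetP (im_iter_sub lt_r) v vk.
Qed.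

Let nus := mkseq card_ker_im d.

Lemma nth_nus k : (k < d)%N -> nth 0%N nus k = card_ker_im k.
Proof. exact: nth_mkseq. Qed.

(** Common form of the two recursive definitions of trees. Here [e] is the number of periodic
    preimages of [y] to be left out: 0 for the trees T^k and 1 for the elementary tree. The
    hypothesis counts children of rank at least [i], which is what the sizes of fibres provide. *)
Lemma hangs_graft_counts y K e :
    (0 < K <= d)%N ->
    (forall i, #|[set v | child s depth y v & (i <= rank v)%N]| =
               if (i < K)%N then (card_ker_im i - e)%N else 0%N) ->
    (forall i, (i < K)%N -> (e <= card_ker_im i)%N) ->
    (forall v, child s depth y v -> hangs s depth v (subtree nus (rank v))) ->
  hangs s depth y
    (graft (nseq (nth 0%N nus K.-1 - e) (subtree nus K.-1) ++
       \big[cat/[::]]_(1 <= i < K)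
          nseq (nth 0%N nus i.-1 - nth 0%N nus i) (subtree nus i.-1))).
Proof.
case: K => // K /= leKd countE le_e hch.
pose rs := nseq (nth 0%N nus K - e) K ++
  \big[cat/[::]]_(1 <= i < K.+1) nseq (nth 0%N nus i.-1 - nth 0%N nus i) i.-1.
have -> : nseq (nth 0%N nus K - e) (subtree nus K) ++
    \big[cat/[::]]_(1 <= i < K.+1)
       nseq (nth 0%N nus i.-1 - nth 0%N nus i) (subtree nus i.-1)
  = map (subtree nus) rs.
  rewrite map_cat map_nseq; congr (_ ++ _).
  rewrite (big_morph (map (subtree nus)) (map_cat _) (erefl _)).
  by apply: eq_bigr => i _; rewrite map_nseq.
apply: hangs_graft_ranked (hch) => [|j]; first exact: depthS.
(* The number of children of rank exactly [j] is a difference of two cumulative counts. *)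
have -> : #|[pred v | child s depth y v & rank v == j]| =
  (#|[set v | child s depth y v & (j <= rank v)%N]| -
   #|[set v | child s depth y v & (j < rank v)%N]|)%N.
  have sub : [set v | child s depth y v & (j < rank v)%N] \subset
             [set v | child s depth y v & (j <= rank v)%N].
    by apply/subsetP=> v; rewrite !inE => /andP[-> /ltnW].
  rewrite -cardsDS //; apply: eq_card => v; rewrite !inE.
  by rewrite eqn_leq; case: child => //=; rewrite -leqNgt.
rewrite !countE count_cat count_nseq /=.
rewrite (big_morph (count_mem j) (count_cat _) (erefl _)).
under eq_bigr do rewrite count_nseq.
rewrite big_add1 /=.
have [lt_jK | lt_Kj | ->] := ltngtP j K.
- rewrite (ltn_trans lt_jK) // ltnS lt_jK mul0n add0n.
  rewrite big_mkord (bigD1 (Ordinal lt_jK)) //= eqxx mul1n big1 ?addn0.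
    rewrite !nth_nus ?(leq_trans _ leKd) ?ltnS ?(ltnW lt_jK) //.
    (* With truncated subtraction, [e] cancels because it is at most the smaller count. *)
    by rewrite subnBA ?subnK ?le_e ?ltnS // ltnW.
  by move=> i neq_i; rewrite -val_eqE /= in neq_i; rewrite (negPf neq_i).
- rewrite !ltnS (leqNgt j K) lt_Kj (ltnNge j K) (ltnW lt_Kj) /= mul0n.
  rewrite big_mkord big1 // => i _.
  by rewrite ltn_eqF // (ltn_trans (ltn_ord i)).
- rewrite ltnSn ltnn ?eqxx mul1n subn0 big_mkord big1.
    by rewrite addn0 nth_nus.
  by move=> i _; rewrite ltn_eqF.
Qed.

(** Strong induction on the rank: a preimage of [y] in the [i]-th image puts [y] in the next one, so
    every preimage has smaller rank than [y]. None is periodic, because [P] is stable under [s]. *)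
Lemma hangs_subtree y : y \notin P -> hangs s depth y (subtree nus (rank y)).
Proof.
have [k] := ubnP (rank y); elim: k y => // k IHk y /ltnSE le_yk yP.
have child_notin v : s v = y -> v \notin P.
  by move=> svy; apply/negP=> /stableS; rewrite svy; apply/negP.
have rank_child v : s v = y -> (rank v < rank y)%N.
  move=> svy; rewrite rankP // -svy im_iterS imset_f // -rankP //.
  exact: child_notin.
have [r0 | r_gt0] := posnP (rank y).
  rewrite r0; apply: hangs_bullet; first exact: depthS.
  move=> v; rewrite childE; apply/negP=> /andP[_ /eqP/rank_child].
  by rewrite r0.
(* This displays the case [e = 0] of the counting lemma. *)
rewrite subtreeE // -[in X in nseq X](subn0 (nth _ _ _)).
apply: hangs_graft_counts => //; first by rewrite r_gt0 ltnW ?rank_lt.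
  move=> i; rewrite subn0; case: ifP => [lt_i | /negbT].
    have yi : y \in im_iter i.+1 by rewrite -rankP.
    rewrite -(card_fiber_im yi); apply: eq_card => v; rewrite !inE childE.
    case: eqP => [svy|]; rewrite ?andbF // !andbT child_notin //=.
    by rewrite rankP ?child_notin.
  rewrite -leqNgt => le_i; apply: eq_card0 => v; rewrite !inE childE.
  apply/negP=> /andP[/andP[_ /eqP/rank_child lt_r]].
  by rewrite leqNgt (leq_trans lt_r le_i).
move=> v; rewrite childE => /andP[vP /eqP/rank_child lt_r].
exact: IHk (leq_trans lt_r le_yk) vP.
Qed.

Lemma hangs_elementary_tree y : y \in P ->
  hangs s depth y (elementary_tree nus).
Proof.
move=> yP; rewrite /elementary_tree size_mkseq.
apply: hangs_graft_counts; first by rewrite d_gt0 /=.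
- move=> i; case: ifP => [lt_i | /negbT].
    have yi : y \in im_iter i.+1 by apply: subsetP (im_iter_sub lt_i) y yP.
    (* The preimage [w] in [P] is unique by injectivity of [s] there; removing it from each fibre
       gives [e = 1]. *)
    have /imsetP[w wP yw] : y \in s @: P by rewrite stable_imset.
    have wi : w \in im_iter i by apply: subsetP (im_iter_sub (ltnW lt_i)) w wP.
    have w_in : w \in [set v in im_iter i | s v == y] by rewrite inE wi yw /=.
    rewrite -(card_fiber_im yi) [X in (X - 1)%N](cardsD1 w) w_in add1n subn1 /=.
    apply: eq_card => v; rewrite !inE childE.
    have [vP | vP] /= := boolP (v \in P); last first.
      by rewrite rankP // (contraNneq _ vP) 1?andbC // => ->.
    apply/esym/negP=> /and3P[/eqP nvw _ /eqP svw].
    by apply: nvw; apply: stable_inj => //; rewrite svw.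
  rewrite -leqNgt => le_i; apply: eq_card0 => v; rewrite !inE childE.
  apply/negP=> /andP[/andP[vP _]]; rewrite leqNgt.
  by rewrite (leq_trans (rank_lt vP)).
(* Each kernel contains 0, so 1 can be subtracted from its size. *)
- move=> i lt_i; rewrite card_gt0; apply/set0Pn; exists 0; rewrite !inE.
  have iter0 k : iter k s 0 = 0 by have := iterB k 0 0; rewrite !subrr.
  by rewrite [s 0](iter0 1%N) eqxx andbT -(iter0 i) imset_f.
- by move=> v; rewrite childE => /andP[vP _]; apply: hangs_subtree.
Qed.

End ImageChain.

(** * Decomposition of a functional graph into cycles with trees *)

Lemma functional_graph_iso (V : Type) (s : V -> V) (G : digraph) (psi : G -> V) :
    injective psi -> (forall v, exists a, psi a = v) ->
    (forall a b : G, arc a b -> s (psi a) = psi b) ->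
    (forall a : G, exists b, arc a b) ->
  digraph_iso (functional_graph s) G.
Proof.
move=> inj_psi surj_psi psi_arc out_arc.
have [phi phiK] := choice surj_psi.
have psiK : cancel psi phi by move=> a; apply: inj_psi; rewrite phiK.
exists phi; split; first by exists psi.
move=> x y; split=> /= [sxy | /psi_arc]; last by rewrite !phiK.
(* Preservation of arcs suffices: [phi x] has some out-arc, and its end is forced because [s] is a
   function. *)
have [b ab] := out_arc (phi x); suff -> : phi y = b by [].
by rewrite -sxy -(psiK b) -(psi_arc _ _ ab) phiK.
Qed.

Section CycleDecomposition.
Variables (V : finType) (x0 : V) (s : V -> V) (D : V -> nat) (T : rooted).
Variables (I : eqType) (key : V -> I) (m : I -> nat).

Let P : {pred V} := [pred v | D v == 0%N].

Hypothesis Ds : forall v, D (s v) = (D v).-1.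
Hypothesis inj_sP : {in P &, injective s}.
Hypothesis hangsP : forall y, y \in P -> hangs s D y T.
Hypothesis key_s : forall v, v \in P -> key (s v) = key v.
Hypothesis m_gt0 : forall v, v \in P -> (0 < m (key v))%N.
Hypothesis iter_m : forall v, v \in P -> iter (m (key v)) s v = v.
Hypothesis m_min : forall v k, v \in P -> (0 < k)%N -> iter k s v = v ->
  (m (key v) <= k)%N.

Let N i := #|[pred v in P | key v == i]|.

Let sP v : v \in P -> s v \in P.
Proof. by rewrite !inE Ds => /eqP->. Qed.

Let iterP k v : v \in P -> iter k s v \in P.
Proof. by move=> vP; elim: k => //= k; apply: sP. Qed.

Let key_iter k v : v \in P -> key (iter k s v) = key v.
Proof. by move=> vP; elim: k => //= k IHk; rewrite key_s ?iterP. Qed.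

(* The orbit-counting lemmas of fingraph require a globally injective map. *)
Let sigma v := if v \in P then s v else v.

Let sigma_inj : injective sigma.
Proof.
move=> v w; rewrite /sigma; case: ifP => vP; case: ifP => wP //.
- exact: inj_sP.
- by move=> e; rewrite -e sP in wP.
- by move=> e; rewrite e sP in vP.
Qed.

Let iter_sigma k v : v \in P -> iter k sigma v = iter k s v.
Proof. by move=> vP; elim: k => //= k ->; rewrite /sigma iterP. Qed.

Let order_sigma v : v \in P -> order sigma v = m (key v).
Proof.
move=> vP; apply/eqP; rewrite eqn_leq; apply/andP; split; last first.
  by apply: m_min; rewrite ?order_gt0 // -iter_sigma // iter_order.
rewrite leqNgt; apply/negP=> lt_m.
have := findex_iter lt_m; rewrite iter_sigma // iter_m // findex0.
by move=> e; have := m_gt0 vP; rewrite -e.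
Qed.

(** One point on each cycle of key [i]: the canonical representatives of the orbits of [sigma]. *)
Let rep i : {pred V} := [predI froots sigma & [pred v in P | key v == i]].

(** The periodic points of key [i] are closed under [sigma] and all their orbits have [m i]
    elements, so the quotient is exact and counts orbits. *)
Let card_rep i : #|rep i| = (N i %/ m i)%N.
Proof.
pose a : {pred V} := [pred v in P | key v == i].
have fcardE : fcard sigma a = #|rep i| by apply: eq_card => v; rewrite !inE.
have rep_a : rep i \subset a by apply/subsetP=> v /andP[].
(* The empty class is treated apart, since [m i] is known to be positive only for keys that occur at
   periodic points. *)
have [a0 | /card_gt0P[v /andP[vP /eqP key_v]]] := posnP #|a|.
  by apply/eqP; rewrite [N i]a0 div0n -leqn0 -[X in (_ <= X)%N]a0 subset_leq_card.
rewrite -[N i](@fcard_order_set V sigma sigma_inj (m i) a).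
- by rewrite mulnK ?fcardE // -key_v m_gt0.
- by apply/subsetP=> w /andP[wP /eqP <-]; rewrite inE order_sigma.
apply: (intro_closed (fconnect_sym sigma_inj)) => u w /= /eqP <- /andP[uP ku].
by rewrite /sigma uP; apply/andP; split; [apply: sP | rewrite /= key_s].
Qed.

Let repr i (j : nat) := nth x0 (enum (rep i)) j.

Let reprP i j : (j < N i %/ m i)%N ->
  [/\ repr i j \in P, key (repr i j) = i & froot sigma (repr i j) = repr i j].
Proof.
rewrite -card_rep cardE => /(mem_nth x0); rewrite mem_enum.
by case/and3P=> /eqP ? ? /eqP ?.
Qed.

(** The vertex with key [i], cycle number [j], position [k] and tree node [a] goes to the image of
    [a] in the tree hanging at the [k]-th iterate of the [j]-th representative. *)
Lemma functional_graph_cycles :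
  digraph_iso (functional_graph s)
    (dsum (fun i : I => copies (N i %/ m i) (Cyc (m i) T))).
Proof.
have [tau tauP] : exists tau : V -> T -> V, forall y, y \in P ->
    [/\ injective (tau y), tau y (root T) = y,
        forall v, above s D y v <-> exists a, tau y a = v,
        forall a b : T, arc a b -> s (tau y a) = tau y b
      & forall a, a = root T \/ exists b, arc a b].
  have tau_ex y : exists t : T -> V, y \in P ->
      [/\ injective t, t (root T) = y,
          forall v, above s D y v <-> exists a, t a = v,
          forall a b : T, arc a b -> s (t a) = t b
        & forall a, a = root T \/ exists b, arc a b].
    have [/hangsP[t tP] | yNP] := boolP (y \in P); first by exists t.
    (* A dummy map off [P], so that [tau] can be chosen as a total function. *)
    by exists (fun=> y).
  exists (fun y => projT1 (cid (tau_ex y))) => y.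
  exact: projT2 (cid (tau_ex y)).
(* The foot of the tree is recovered from any of its points, which separates the trees of distinct
   periodic points. *)
have tau_root y a : y \in P -> iter (D (tau y a)) s (tau y a) = y.
  move=> yP; have [_ _ tau_above _ _] := tauP y yP.
  have /andP[_] : above s D y (tau y a) by apply/tau_above; exists a.
  by rewrite (eqP yP) subn0 => /eqP.
have cycP i j k : (j < N i %/ m i)%N -> iter k s (repr i j) \in P.
  by move=> /reprP[rP _ _]; apply: iterP.
pose psi (u : dsum (fun i : I => copies (N i %/ m i) (Cyc (m i) T))) : V :=
  tau (iter (projT2 (projT2 u)).1 s (repr (projT1 u) (projT1 (projT2 u))))
      (projT2 (projT2 u)).2.
apply: (@functional_graph_iso V s _ psi).
- move=> [i [j [k a]]] [i' [j' [k' a']]]; rewrite /psi /= => e.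
  have [rP ri rr] := reprP (ltn_ord j); have [rP' ri' rr'] := reprP (ltn_ord j').
  have yP := cycP i j k (ltn_ord j); have yP' := cycP i' j' k' (ltn_ord j').
  have ey : iter k s (repr i j) = iter k' s (repr i' j').
    by rewrite -(tau_root _ a yP) -(tau_root _ a' yP') e.
  have ei : i = i' by rewrite -ri -(key_iter k rP) ey key_iter.
  case: i' / ei j' k' rP' ri' rr' e yP' ey => j' k' rP' ri' rr' e yP' ey.
  have ej : j = j'.
    apply/ord_inj/eqP; rewrite -(nth_uniq x0 _ _ (enum_uniq (rep i))).
    + have froot_iter z l : z \in P -> froot sigma (iter l s z) = froot sigma z.
        move=> zP; apply/esym/(fingraph.rootP (fconnect_sym sigma_inj)).
        by rewrite -iter_sigma // fconnect_iter.
      by rewrite -[nth _ _ j]rr -[nth _ _ j']rr' -(froot_iter _ k) // ey froot_iter.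
    + by rewrite -cardE card_rep.
    + by rewrite -cardE card_rep.
  case: j' / ej rP' ri' rr' e yP' ey => _ _ _ e yP' ey.
  have ek : k = k'.
    apply/ord_inj; have o := order_sigma rP; rewrite ri in o.
    rewrite -(@findex_iter _ sigma (repr i j) k) ?o // iter_sigma // ey.
    by rewrite -iter_sigma // findex_iter ?o.
  by case: k' / ek e yP' ey => e _ _; have [/(_ _ _ e)-> _ _ _ _] := tauP _ yP.
- move=> v; pose y := iter (D v) s v.
  have yP : y \in P by rewrite inE (depth_iter Ds) subnn.
  have [_ _ tau_above _ _] := tauP y yP.
  have /tau_above[a ya] : above s D y v by rewrite /above (eqP yP) subn0 /=.
  pose i := key y; pose r := froot sigma y.
  have : fconnect sigma r y by rewrite fconnect_sym // connect_root.
  rewrite fconnect_orbit; case/trajectP=> k lt_k yk.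
  have rP : r \in P.
    (* Points outside [P] are fixed by [sigma], so an orbit starting there never enters [P]. *)
    apply: contraLR yP => rNP; rewrite yk.
    have -> : iter k sigma r = r; last by [].
    by elim: k {lt_k yk} => //= k ->; rewrite /sigma (negPf rNP).
  have ri : key r = i by rewrite /i yk iter_sigma // key_iter.
  have r_rep : r \in enum (rep i).
    rewrite mem_enum; apply/and3P; split; [|exact: rP|exact/eqP].
    by apply: roots_root; apply: fconnect_sym.
  have lt_j : (index r (enum (rep i)) < N i %/ m i)%N.
    by rewrite -card_rep cardE index_mem.
  rewrite order_sigma // ri in lt_k.
  exists (existT _ i (existT _ (Ordinal lt_j) (Ordinal lt_k, a))).
  by rewrite /psi /= /repr nth_index // -iter_sigma // -yk.
- move=> _ _ [i [_ [_ [-> -> [j [[k a] [[k' a'] [-> -> /= arc_ka]]]]]]]].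
  rewrite /psi /=; have yP := cycP i j k (ltn_ord j).
  have [_ tr _ t_arc _] := tauP _ yP.
  case: arc_ka => /= [[<- /t_arc] // | [-> -> ->]].
  have [_ tr' _ _ _] := tauP _ (cycP i j (ordS k) (ltn_ord j)).
  rewrite tr tr' /= -iterS.
  have [rP ri _] := reprP (ltn_ord j).
  (* At the last position [ordS] returns to 0, which agrees with [s] because [m i] steps close the
     cycle. *)
  have := ltn_ord k; rewrite leq_eqVlt => /predU1P[ek|lt_k]; last first.
    by rewrite modn_small.
  by rewrite ek modnn /=; move: (iter_m rP); rewrite ri.
- move=> [i [j [k a]]].
  have [_ _ _ _ /(_ a)[-> | [b ab]]] := tauP _ (cycP i j k (ltn_ord j)).
    exists (existT _ i (existT _ j (ordS k, root T))), i.
    exists (existT _ j (k, root T)), (existT _ j (ordS k, root T)); split=> //.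
    by exists j, (k, root T), (ordS k, root T); split=> //; right.
  exists (existT _ i (existT _ j (k, b))), i.
  exists (existT _ j (k, a)), (existT _ j (k, b)); split=> //.
  by exists j, (k, a), (k, b); split=> //; left.
Qed.

End CycleDecomposition.

(** * Modules over F[x]: kernels and annihilators *)

Definition poly_action (F : finFieldType) (V : zmodType)
    (act : {poly F} -> V -> V) : Prop :=
  [/\ forall v, act 1 v = v,
      forall p q v, act (p - q) v = act p v - act q v,
      forall p q v, act (p * q) v = act p (act q v)
    & forall p v w, act p (v - w) = act p v - act p w].

(** The keys will be polynomials, an infinite type, so the sum runs over a finite list [S] that
    contains all values of [h]. *)
Lemma big_fiber_card (V : finType) (I : eqType) (h : V -> I) (S : seq I)
    (Q : pred I) : uniq S -> (forall v, h v \in S) ->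
  #|[set v | Q (h v)]| = (\sum_(e <- S | Q e) #|[set v | h v == e]|)%N.
Proof.
move=> US hS; rewrite -sum1_card.
under [RHS]eq_bigr do rewrite -sum1dep_card big_mkcond.
rewrite exchange_big /= big_mkcond; apply: eq_bigr => v _; rewrite inE.
rewrite big_mkcond (bigD1_seq (h v)) //= eqxx big1_seq ?addn0 // => e.
by rewrite eq_sym => /andP[/negPf-> _]; case: ifP.
Qed.

Section PolyAction.
Variables (F : finFieldType) (V : finZmodType) (act : {poly F} -> V -> V).
Hypothesis actP : poly_action act.
Implicit Types p q g e m : {poly F}.

Let act1 v : act 1 v = v. Proof. by case: actP. Qed.
Let actBl p q v : act (p - q) v = act p v - act q v. Proof. by case: actP. Qed.
Let actM p q v : act (p * q) v = act p (act q v). Proof. by case: actP. Qed.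
Let actB p v w : act p (v - w) = act p v - act p w. Proof. by case: actP. Qed.

Definition act_ker p : {set V} := [set v | act p v == 0].

Lemma act0l v : act 0 v = 0.
Proof. by rewrite -(subrr 0) actBl subrr. Qed.

Lemma act0r p : act p 0 = 0.
Proof. by have := actB p 0 0; rewrite !subrr. Qed.

Lemma actDl p q v : act (p + q) v = act p v + act q v.
Proof.
have -> : p + q = p - (0 - q) by rewrite sub0r opprK.
by rewrite !actBl act0l sub0r opprK.
Qed.

Lemma act_iter f k v : iter k (act f) v = act (f ^+ k) v.
Proof. by elim: k => [|k IHk] /=; rewrite ?act1 // IHk exprS actM. Qed.

Lemma act_ker_dvd p q : p %| q -> act_ker p \subset act_ker q.
Proof.
move=> /divpK <-; apply/subsetP=> v; rewrite !inE actM => /eqP->.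
by rewrite act0r.
Qed.

Lemma act_ker_Bezout p q v :
  act p v = 0 -> act q v = 0 -> act (gcdp p q) v = 0.
Proof.
move=> pv qv; have [[a b] /= /(eqp_dvdl (gcdp p q))] := Bezoutp p q.
rewrite dvdpp => /divpK <-.
by rewrite actM actDl !actM pv qv !act0r addr0 act0r.
Qed.

Lemma card_act_ker_im p : (#|act_ker p| * #|im_iter (act p) 1| = #|V|)%N.
Proof.
have im0 : im_iter (act p) 0 = setT.
  by apply/setP => v; rewrite inE; apply/imsetP; exists v.
have := card_im_iterS (actB p) 0; rewrite /card_ker_im im0 cardsT => ->.
by congr (_ * _)%N; apply: eq_card => v; rewrite !inE.
Qed.

(** A nonzero polynomial of least degree killing [v] divides every other one, because the remainder
    of a division also kills [v]. *)
Lemma annihilator_ex m v : m != 0 -> act m v = 0 ->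
  exists g, g \is monic /\ forall p, (act p v == 0) = (g %| p).
Proof.
have [n] := ubnP (size m); elim: n m => // n IHn m /ltnSE le_m m0 mv.
have [[r [r0 rm rv]] | no_r] :=
  pselect (exists r : {poly F}, [/\ r != 0, (size r < size m)%N & act r v = 0]).
  by apply: (IHn r) => //; apply: leq_trans rm le_m.
exists ((lead_coef m)^-1 *: m); have lc0 : (lead_coef m)^-1 != 0.
  by rewrite invr_eq0 lead_coef_eq0.
split; first by rewrite monicE lead_coefZ mulVf // lead_coef_eq0.
move=> p; rewrite dvdpZl //; apply/eqP/idP=> [pv | /divpK <-]; last first.
  by rewrite actM mv act0r.
rewrite /dvdp; apply: contra_notT no_r => r0; exists (p %% m).
split; rewrite ?ltn_modp //.
have -> : p %% m = p - p %/ m * m by apply/esym/eqP; rewrite subr_eq addrC -divp_eq.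
by rewrite actBl actM mv act0r pv subrr.
Qed.

Variable m : {poly F}.
Hypothesis m_neq0 : m != 0.
Hypothesis act_m : forall v, act m v = 0.

Lemma act_ker_gcd p : act_ker p = act_ker (gcdp p m).
Proof.
apply/eqP; rewrite eqEsubset (act_ker_dvd (dvdp_gcdl p m)) andbT.
by apply/subsetP=> v; rewrite !inE => /eqP pv; apply/eqP/act_ker_Bezout.
Qed.

Definition annp v := projT1 (cid (annihilator_ex m_neq0 (act_m v))).

Lemma annp_monic v : annp v \is monic.
Proof. by rewrite /annp; case: cid => g []. Qed.

Lemma annpP v p : (act p v == 0) = (annp v %| p).
Proof. by rewrite /annp; case: cid => g []. Qed.

Lemma annp_eq v g : g \is monic -> (forall p, (act p v == 0) = (g %| p)) ->
  annp v = g.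
Proof.
move=> gmon gP; apply/eqP; rewrite -eqp_monic ?annp_monic // /eqp.
by rewrite -gP annpP dvdpp -annpP gP dvdpp.
Qed.

Section Counting.
Hypothesis cardV : #|V| = (#|F| ^ (size m).-1)%N.
Hypothesis card_ker_le : forall e, e %| m -> (#|act_ker e| <= #|F| ^ (size e).-1)%N.

Let q_gt0 k : (0 < #|F| ^ k)%N.
Proof. by rewrite expn_gt0 (ltn_trans _ (finNzRing_gt1 F)). Qed.

(** Write [m] as [c * e]. The image of [e] lies in the kernel of [c], so it has at most q^(deg c)
    elements; since kernel and image sizes multiply to q^(deg c + deg e), the upper bound on the
    kernel of [e] is attained. *)
Lemma card_act_ker e : e %| m -> #|act_ker e| = (#|F| ^ (size e).-1)%N.
Proof.
move=> em; apply/eqP; rewrite eqn_leq card_ker_le //=.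
have mE := divpK em; set c := m %/ e in mE.
have /andP[c0 e0] : (c != 0) && (e != 0) by rewrite -negb_or -mulf_eq0 mE.
rewrite -(leq_pmul2r (q_gt0 (size c).-1)) -expnD.
have -> : ((size e).-1 + (size c).-1 = (size m).-1)%N.
  rewrite -mE size_mul //; move: c0 e0; rewrite -!size_poly_gt0.
  by case: (size c) => // a; case: (size e) => // b _ _; rewrite addSn addnS addnC.
rewrite -cardV -(card_act_ker_im e) leq_mul2l; apply/orP; right.
apply: leq_trans (card_ker_le (dvdp_trans (dvdp_mulr e (dvdpp c)) _)); last first.
  by rewrite mE.
apply/subset_leq_card/subsetP=> _ /imsetP[v _ ->]; rewrite inE /=.
by rewrite -actM mE act_m.
Qed.

Lemma card_act_ker_gcd p : #|act_ker p| = (#|F| ^ (size (gcdp p m)).-1)%N.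
Proof. by rewrite act_ker_gcd card_act_ker ?dvdp_gcdr. Qed.

End Counting.

End PolyAction.

(** The kernel of [g] is the disjoint union, over the monic divisors [e] of [g], of the sets of
    elements with annihilator [e]. By induction on the degree the proper divisors contribute equally
    in both modules, hence so does [g]. *)
Lemma card_annp_eq (F : finFieldType) (V V' : finZmodType)
    (act : {poly F} -> V -> V) (act' : {poly F} -> V' -> V')
    (actP : poly_action act) (actP' : poly_action act') (m m' : {poly F})
    (m_neq0 : m != 0) (m_neq0' : m' != 0)
    (act_m : forall v, act m v = 0) (act_m' : forall v, act' m' v = 0) g :
    g \is monic ->
    (forall e, e %| g -> #|act_ker act e| = #|act_ker act' e|) ->
  #|[set v | annp actP m_neq0 act_m v == g]| =
  #|[set v | annp actP' m_neq0' act_m' v == g]|.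
Proof.
set an := annp _ _ _; set an' := annp _ _ _.
have [n] := ubnP (size g); elim: n g => // n IHn g /ltnSE le_g g_mon kerE.
(* All annihilators that occur in either module, together with [g], which might occur in neither. *)
pose S := undup (g :: [seq an v | v <- enum V] ++ [seq an' v | v <- enum V']).
have US : uniq S by apply: undup_uniq.
have anS v : an v \in S.
  by rewrite mem_undup inE mem_cat map_f ?mem_enum ?orbT.
have anS' v : an' v \in S.
  by rewrite mem_undup inE mem_cat (map_f an') ?mem_enum ?orbT.
have gS : g \in S by rewrite mem_undup inE eqxx.
have monS e : e \in S -> e \is monic.
  rewrite mem_undup inE mem_cat => /orP[/eqP-> //|].
  by case/orP=> /mapP[v _ ->]; apply: annp_monic.
have := kerE g (dvdpp g).
have -> : act_ker act g = [set v | an v %| g].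
  by apply/setP => v; rewrite !inE -annpP.
have -> : act_ker act' g = [set v | an' v %| g].
  by apply/setP => v; rewrite !inE -annpP.
rewrite (big_fiber_card (fun e => e %| g) US anS).
rewrite (big_fiber_card (fun e => e %| g) US anS').
rewrite -!(big_filter S) !(bigD1_seq g) ?mem_filter ?dvdpp ?filter_uniq //=.
rewrite !big_filter_cond !(big_seq_cond (fun e => (e %| g) && _)).
set s := (\sum_(_ <- _ | _) _)%N; set s' := (\sum_(_ <- _ | _) _)%N.
suff -> : s = s' by move/eqP; rewrite eqn_add2r => /eqP.
apply: eq_bigr => e /and3P[/monS e_mon eg neq_eg].
apply: IHn => // [|e' e'e]; last by apply: kerE; apply: dvdp_trans e'e eg.
apply: leq_trans le_g; rewrite ltn_neqAle dvdp_leq ?monic_neq0 // andbT.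
apply: contraNneq neq_eg => szE.
by rewrite -eqp_monic // -dvdp_size_eqp // szE.
Qed.

(** * The module F[x]/<g> and its units *)

Lemma dvdp_div_gcd_mul (F : fieldType) (g r : {poly F}) :
  g %| g %/ gcdp g r * r.
Proof.
have dg := dvdp_gcdl g r; have dr := dvdp_gcdr g r.
move: (gcdp g r) dg dr => d dg dr.
suff -> : g %/ d * r = r %/ d * g by rewrite dvdp_mull.
by rewrite -[in LHS](divpK dr) mulrCA divpK.
Qed.

(** Dividing [g] by a nonconstant gcd would leave a nonzero polynomial of smaller degree, which [g]
    cannot divide. *)
Lemma coprimep_dvd_div_gcd (F : fieldType) (g r : {poly F}) :
  g != 0 -> g %| g %/ gcdp g r -> coprimep g r.
Proof.
move=> g0 /(dvdp_leq _); rewrite dvdp_div_eq0 ?dvdp_gcdl // => /(_ g0).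
have d0 : gcdp g r != 0 by rewrite gcdp_eq0 negb_and g0.
rewrite size_divp // leqNgt ltn_subrL size_poly_gt0 g0 andbT -eqn0Ngt.
by rewrite coprimep_def; move: d0; rewrite -size_poly_gt0; case: (size _) => [|[]].
Qed.

Section QuotientModule.
Variables (F : finFieldType) (g : {poly F}).
Hypotheses (g_mon : g \is monic) (g_gt1 : (1 < size g)%N).

Definition qact (p : {poly F}) (r : {poly %/ g}) : {poly %/ g} :=
  in_qpoly g p * r.

Lemma mk_monicE : mk_monic g = g.
Proof. by rewrite /mk_monic g_gt1 g_mon. Qed.

Lemma qact_action : poly_action qact.
Proof.
split=> [r|p q r|p q r|p r t]; rewrite /qact.
- by rewrite rmorph1 mul1r.
- by rewrite rmorphB mulrBl.
- by rewrite rmorphM mulrA.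
- by rewrite mulrBr.
Qed.

Lemma qact_eq0 p r : (qact p r == 0) = (g %| p * r).
Proof.
rewrite -val_eqE /= -[X in X %| _]mk_monicE.
rewrite Pdiv.RingMonic.rmodp_mulml ?monic_mk_monic //.
by rewrite /dvdp Pdiv.IdomainMonic.modpE ?monic_mk_monic.
Qed.

Lemma qact_g r : qact g r = 0.
Proof. by apply/eqP; rewrite qact_eq0 dvdp_mulr. Qed.

(** With [g] equal to [c * e], the classes killed by [e] are those of the multiples of [c]; division
    by [c] injects them into the polynomials of degree less than deg e. *)
Lemma card_qact_ker_le e : e %| g -> (#|act_ker qact e| <= #|F| ^ (size e).-1)%N.
Proof.
move=> eg; have gE := divpK eg; set c := g %/ e in gE.
have g0 := monic_neq0 g_mon.
have /andP[c0 e0] : (c != 0) && (e != 0) by rewrite -negb_or -mulf_eq0 gE.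
pose h (r : {poly %/ g}) : {poly_(size e).-1 F} := npolyp _ ((r : {poly F}) %/ c).
have cr (r : {poly %/ g}) : r \in act_ker qact e -> (r : {poly F}) %/ c * c = r.
  rewrite inE qact_eq0; move: (polyn r) => {}r.
  rewrite -gE [c * e]mulrC dvdp_mul2l // => cr.
  by rewrite divpK.
have sz (r : {poly %/ g}) : (size ((r : {poly F}) %/ c)%R <= (size e).-1)%N.
  move: (size_mk_monic r); move: (polyn r) => {}r.
  rewrite mk_monicE -gE size_mul // size_divp //.
  move: c0 e0; rewrite -!size_poly_gt0; case: (size c) => // a.
  case: (size e) => // b _ _; rewrite addSn addnS /= ltnS => le_r.
  by rewrite leq_subLR.
have h_inj : {in act_ker qact e &, injective h}.
  move=> r r' /cr rE /cr rE' /(congr1 (@polyn _ _)).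
  by rewrite !npolypK // => rr'; apply: val_inj; rewrite /= -rE -rE' rr'.
by rewrite -(card_in_imset h_inj) -card_npoly max_card.
Qed.

Lemma card_qact_ker e : e %| g -> #|act_ker qact e| = (#|F| ^ (size e).-1)%N.
Proof.
apply: (card_act_ker qact_action (monic_neq0 g_mon) qact_g).
  by rewrite card_monic_qpoly.
exact: card_qact_ker_le.
Qed.

Lemma annp_qactE r :
  (annp qact_action (monic_neq0 g_mon) qact_g r == g) = (r \is a GRing.unit).
Proof.
apply/eqP/idP=> [ann_r | ur].
  (* Being a unit of the quotient unfolds to coprimality with the modulus. *)
  change (is_true (coprimep (mk_monic g) r)); rewrite [X in coprimep X _]mk_monicE.
  apply: coprimep_dvd_div_gcd; first exact: monic_neq0.
  by rewrite -[X in X %| _]ann_r -annpP qact_eq0 dvdp_div_gcd_mul.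
apply: annp_eq => // p; rewrite /qact -(mul0r r) (inj_eq (mulIr ur)) -val_eqE /=.
by rewrite mk_monicE /dvdp Pdiv.IdomainMonic.modpE.
Qed.

End QuotientModule.

(** Comparison with F[x]/<g>, whose kernels have the same sizes and where the elements of
    annihilator [g] are the units. *)
Lemma card_annp_Phi (F : finFieldType) (V : finZmodType)
    (act : {poly F} -> V -> V) (actP : poly_action act) (m : {poly F})
    (m_neq0 : m != 0) (act_m : forall v, act m v = 0) g :
    g \is monic ->
    (forall e, e %| g -> #|act_ker act e| = (#|F| ^ (size e).-1)%N) ->
  #|[set v | annp actP m_neq0 act_m v == g]| = Phi g.
Proof.
move=> g_mon kerE; rewrite /Phi; case: leqP => [le_g1 | g_gt1].
  have g1 : g = 1.
    apply/eqP; rewrite -eqp_monic ?monic1 // -size_poly_eq1 eqn_leq le_g1.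
    by rewrite size_poly_gt0 monic_neq0.
  rewrite g1 in kerE *; rewrite -[RHS](expn0 #|F|).
  (* For [g = 1] the elements in question form the kernel of the identity, of size q^0. *)
  have := kerE 1 (dvdpp 1); rewrite size_poly1 => <-.
  apply: eq_card => v; rewrite !inE (annpP actP m_neq0 act_m v 1).
  by rewrite dvdp1 size_poly_eq1 eqp_monic ?annp_monic ?monic1.
rewrite (monicP g_mon) invr1 scale1r.
rewrite (card_annp_eq actP (qact_action g) _ (monic_neq0 g_mon) _
  (qact_g g_mon g_gt1)) //.
  by apply: eq_card => r; rewrite !inE annp_qactE.
by move=> e eg; rewrite kerE // card_qact_ker.
Qed.

(** * The nu-series and the gcds of N with powers of f *)

Section NuGcds.
Variable F : finFieldType.
Implicit Types N f B : {poly F}.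

Lemma gcdp_exprS N f B k : N != 0 -> B %= gcdp N (f ^+ k) ->
  B * gcdp (N %/ B) f %= gcdp N (f ^+ k.+1).
Proof.
move=> N0 BE.
have BN : B %| N by rewrite (eqp_dvdl _ BE) dvdp_gcdl.
have Bf : B %| f ^+ k by rewrite (eqp_dvdl _ BE) dvdp_gcdr.
have NE := divpK BN; have fE := divpK Bf.
set C := N %/ B in NE *; set E := f ^+ k %/ B in fE.
have B0 : B != 0 by apply: contraNneq N0 => B0; rewrite -NE B0 mulr0.
have CE : coprimep C E.
  rewrite /coprimep size_poly_eq1 -(eqp_mul2r _ _ B0) mul1r.
  by rewrite -(eqp_ltrans (gcdp_mul2r _ _ _)) NE fE eqp_sym.
rewrite -NE exprS -fE mulrA mulrC [f * E]mulrC eqp_sym.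
apply: eqp_trans (gcdp_mul2r _ _ _) _.
by rewrite eqp_mul2r // Gauss_gcdpr.
Qed.

Lemma size_nu_gcds N f k : size (nu_gcds N f k) = k.
Proof. by elim: k => //= k IHk; rewrite size_rcons IHk. Qed.

Lemma prod_nu_gcdsS N f k : \prod_(A <- nu_gcds N f k.+1) A =
  \prod_(A <- nu_gcds N f k) A * gcdp (N %/ \prod_(A <- nu_gcds N f k) A) f.
Proof. by rewrite /= -cats1 big_cat big_seq1. Qed.

Lemma prod_nu_gcds N f k : N != 0 ->
  \prod_(A <- nu_gcds N f k) A %= gcdp N (f ^+ k).
Proof.
move=> N0; elim: k => [|k IHk].
  by rewrite big_nil expr0 eqp_sym gcdp1.
by rewrite prod_nu_gcdsS gcdp_exprS.
Qed.

Lemma nth_nu_gcds N f k i : (i < k)%N ->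
  nth 0 (nu_gcds N f k) i = gcdp (N %/ \prod_(A <- nu_gcds N f i) A) f.
Proof.
elim: k => // k IHk; rewrite ltnS /= nth_rcons size_nu_gcds.
by case: ltngtP => // [/IHk //|-> _].
Qed.

(** This makes each term of the nu-series the quotient of the sizes of two consecutive kernels. *)
Lemma deg_gcdp_exprS N f k i : N != 0 -> (i < k)%N ->
  ((size (gcdp N (f ^+ i.+1))).-1 =
   (size (gcdp N (f ^+ i))).-1 + (size (nth 0%R (nu_gcds N f k) i)).-1)%N.
Proof.
move=> N0 lt_i; rewrite (nth_nu_gcds _ _ lt_i).
have Bi := prod_nu_gcds f i N0; have := prod_nu_gcds f i.+1 N0.
rewrite prod_nu_gcdsS => /eqp_size <-; rewrite -(eqp_size Bi).
set B := \prod_(A <- _) A in Bi *.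
have g0 : gcdp N (f ^+ i) != 0 by rewrite gcdp_eq0 negb_and N0.
have BN : B %| N by rewrite (eqp_dvdl _ Bi) dvdp_gcdl.
have B0 : B != 0 by apply: contraTneq BN => ->; rewrite dvd0p.
have A0 : gcdp (N %/ B) f != 0 by rewrite gcdp_eq0 negb_and dvdp_div_eq0 // N0.
rewrite size_mul //; move: B0 A0; rewrite -!size_poly_gt0.
by case: (size B) => // a; case: (size _) => // b _ _; rewrite addSn addnS.
Qed.

Lemma nu_lengthP N f k : N != 0 -> (0 < k)%N -> N %| f ^+ k ->
  (0 < nu_length N f)%N /\ N %| f ^+ nu_length N f.
Proof.
move=> N0 k_gt0 Nk.
(* The exponent [k] witnesses existence, which rules out the default value 0 of [least]. *)
have [|/andP[d_gt0 dP] _] := @leastP (fun d => (0 < d)%N &&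
    (\prod_(A <- nu_gcds N f d) A %= N)).
  exists k; rewrite k_gt0 /=; apply: eqp_trans (prod_nu_gcds f k N0) _.
  by rewrite /eqp dvdp_gcdl dvdp_gcd dvdpp.
split=> //; rewrite -(eqp_dvdl _ dP) (eqp_dvdl _ (prod_nu_gcds f _ N0)).
exact: dvdp_gcdr.
Qed.

End NuGcds.

(** * The action of F[x] on a finite extension through linearized polynomials *)

Section FrobeniusAction.
Variables (F : finFieldType) (K : fieldExtType F).
Local Notation q := #|F|.
Implicit Types (f g e : {poly F}) (c : K).

Definition Lact f c : K := (map_poly (in_alg K) (Lpoly f)).[c].

(** The bound [k] is left free so that polynomials of different sizes can be summed over a common
    range. *)
Lemma LactE f k c : (size f <= k)%N ->
  Lact f c = \sum_(i < k) f`_i *: c ^+ (q ^ i).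
Proof.
move=> le_fk; rewrite /Lact /Lpoly rmorph_sum horner_sum /=.
rewrite (big_ord_widen k
  (fun i => (map_poly (in_alg K) (f`_i *: 'X^(q ^ i))).[c]) le_fk).
rewrite big_mkcond; apply: eq_bigr => i _; case: ltnP => [_ | le_i].
  by rewrite map_polyZ map_polyXn hornerZ hornerXn mulr_algl.
by rewrite nth_default // scale0r.
Qed.

Lemma card_pnat p : p \in [pchar F] -> p.-nat q.
Proof.
move=> hp; have := card_pprimeChar hp.
rewrite [#|_|](_ : _ = q) // => ->.
by rewrite pnatX pnat_id ?(pcharf_prime hp).
Qed.

Lemma frobB i : {morph (fun c : K => c ^+ (q ^ i)) : a b / a - b}.
Proof.
move=> a b; have [p p_pr hp] := finPcharP F.
have qK : [pchar K].-nat (q ^ i)%N.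
  have hpK : p \in [pchar K] by rewrite pchar_lalg.
  by rewrite (eq_pnat _ (pcharf_eq hpK)) pnatX card_pnat.
by rewrite exprDn_pchar // exprNn_pchar.
Qed.

Lemma frobZ i (a : F) c : (a *: c) ^+ (q ^ i) = a *: c ^+ (q ^ i).
Proof.
rewrite exprZn; congr (_ *: _); elim: i => [|i IHi]; first by rewrite expr1.
by rewrite expnSr exprM IHi expf_card.
Qed.

Lemma frob_sum i (I : finType) (h : I -> K) :
  (\sum_j h j) ^+ (q ^ i) = \sum_j h j ^+ (q ^ i).
Proof.
have frob0 : (0 : K) ^+ (q ^ i) = 0 by have := frobB i 0 0; rewrite !subrr.
have frobD : {morph (fun c : K => c ^+ (q ^ i)) : a b / a + b}.
  move=> a b; have -> : a + b = a - (0 - b) by rewrite sub0r opprK.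
  by rewrite !frobB frob0 sub0r opprK.
exact: (big_morph _ frobD frob0).
Qed.

(** The Horner step for this action: the factor ['X] acts as the Frobenius map. It serves the
    induction that proves multiplicativity. *)
Lemma LactMXDC f a c : Lact (f * 'X + a%:P) c = Lact f (c ^+ q) + a *: c.
Proof.
rewrite (@LactE _ (size f).+1); last first.
  by rewrite size_MXaddC; case: ifP.
rewrite big_ord_recl -cons_poly_def coef_cons expr1 addrC; congr (_ + _).
rewrite (LactE _ (leqnn (size f))); apply: eq_bigr => i _.
by rewrite coef_cons /= -exprM expnS.
Qed.

Lemma Lact_frob f c : Lact f (c ^+ q) = Lact f c ^+ q.
Proof.
rewrite !(LactE _ (leqnn (size f))) -[in RHS](expn1 q) frob_sum.
by apply: eq_bigr => i _; rewrite frobZ expn1 -!exprM mulnC.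
Qed.

Lemma LactBl f g c : Lact (f - g) c = Lact f c - Lact g c.
Proof.
rewrite !(@LactE _ (maxn (size f) (size g))) ?leq_maxl ?leq_maxr //; last first.
  by rewrite (leq_trans (size_polyD _ _)) // size_polyN.
by rewrite -sumrB; apply: eq_bigr => i _; rewrite coefB scalerBl.
Qed.

Lemma Lact0 c : Lact 0 c = 0.
Proof. by rewrite (@LactE _ 0%N) ?big_ord0 // size_poly0. Qed.

Lemma LactDl f g c : Lact (f + g) c = Lact f c + Lact g c.
Proof.
have -> : f + g = f - (0 - g) by rewrite sub0r opprK.
by rewrite !LactBl Lact0 sub0r opprK.
Qed.

Lemma LactZ a f c : Lact (a *: f) c = a *: Lact f c.
Proof.
rewrite !(@LactE _ (size f)) ?size_scale_leq // scaler_sumr.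
by apply: eq_bigr => i _; rewrite coefZ scalerA.
Qed.

Lemma LactM f g c : Lact (f * g) c = Lact f (Lact g c).
Proof.
elim/poly_ind: f g c => [|f a IHf] g c; first by rewrite mul0r !Lact0.
rewrite mulrDl mul_polyC LactDl LactZ LactMXDC -mulrA [_ * g]mulrC.
(* The Horner step is applied to [g * 'X] with constant term 0, and the Frobenius map commutes with
   the action of [g]. *)
by rewrite IHf -[g * 'X]addr0 -[0]/(0%:P) LactMXDC scale0r addr0 Lact_frob.
Qed.

Lemma Lact_action : poly_action Lact.
Proof.
split=> [c|||]; [|exact: LactBl|exact: LactM|].
  by rewrite (@LactE _ 1) ?size_poly1 // big_ord1 coef1 scale1r expr1.
move=> f c c'; rewrite !(LactE _ (leqnn (size f))) -sumrB.
by apply: eq_bigr => i _; rewrite frobB scalerBr.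
Qed.

Lemma LactXn n c : Lact 'X^n c = c ^+ (q ^ n).
Proof.
rewrite (@LactE _ n.+1) ?size_polyXn // big_ord_recr big1 /= => [|i _].
  by rewrite coefXn eqxx scale1r add0r.
by rewrite coefXn ltn_eqF // scale0r.
Qed.

Lemma card_finvect : #|finvect_type K| = (q ^ \dim {:K})%N.
Proof.
by rewrite -(card_vspacef (Vector.class (finvect_type K : vectType F))) card_vspace.
Qed.

Lemma Lact_Xn_sub1 n c : \dim {:K} = n -> Lact ('X^n - 1) c = 0.
Proof.
move=> dimK; rewrite LactBl LactXn; have [-> _ _ _] := Lact_action.
have := @expf_card (finvect_type K) c.
by rewrite card_finvect dimK => ->; rewrite subrr.
Qed.

Lemma card_Lact_ker e : e != 0 ->
  (#|[set c : finvect_type K | Lact e c == 0%R]| <= q ^ (size e).-1)%N.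
Proof.
move=> e0; set L := map_poly (in_alg K) (Lpoly e).
have sizeL : (size L <= (q ^ (size e).-1).+1)%N.
  rewrite size_map_poly (leq_trans (size_sum _ _ _)) //; apply/bigmax_leqP => i _.
  rewrite (leq_trans (size_scale_leq _ _)) // size_polyXn ltnS.
  rewrite leq_pexp2l ?(ltn_trans _ (finNzRing_gt1 F)) // -ltnS prednK //.
  by rewrite size_poly_gt0.
(* The coefficient of degree q^(deg e) is the leading coefficient of [e]; as q > 1, no other term
   has this exponent. *)
have L0 : L != 0.
  rewrite map_poly_eq0; apply/eqP => /polyP/(_ (q ^ (size e).-1)%N)/eqP.
  have e_gt0 : ((size e).-1 < size e)%N by rewrite prednK // size_poly_gt0.
  rewrite coef0 coef_sum.
  rewrite (bigD1 (Ordinal e_gt0)) //= big1 => [|i neq_i].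
    by rewrite coefZ coefXn eqxx mulr1 addr0 -lead_coefE lead_coef_eq0 (negPf e0).
  rewrite coefZ coefXn eqn_exp2l ?finNzRing_gt1 //.
  by rewrite eq_sym -[_ == _]/(i == Ordinal e_gt0) (negPf neq_i) mulr0.
rewrite cardE -ltnS (leq_trans _ sizeL) //.
apply: (@max_poly_roots (finvect_type K) L); rewrite ?enum_uniq //.
by apply/allP => c; rewrite mem_enum inE.
Qed.

End FrobeniusAction.

(** * The graph of f on a finite module killed by N G *)

Section PolyActionGraph.
Variables (F : finFieldType) (V : finZmodType) (act : {poly F} -> V -> V).
Hypothesis actP : poly_action act.
Variables (N G f : {poly F}).
Let m := N * G.
Hypothesis m_neq0 : m != 0.
Hypothesis act_m : forall v, act m v = 0.
Hypothesis cardV : #|V| = (#|F| ^ (size m).-1)%N.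
Hypothesis card_ker_le :
  forall e, e %| m -> (#|act_ker act e| <= #|F| ^ (size e).-1)%N.
Hypothesis coGf : coprimep G f.
Variable k0 : nat.
Hypothesis k0_gt0 : (0 < k0)%N.
Hypothesis dvdNf : N %| f ^+ k0.

Let s := act f.
Let d := nu_length N f.

Let N0 : N != 0.
Proof. by apply: contraNneq m_neq0; rewrite /m => ->; rewrite mul0r. Qed.
Let G0 : G != 0.
Proof. by apply: contraNneq m_neq0; rewrite /m => ->; rewrite mulr0. Qed.

Let size_m : (size m).-1 = ((size N).-1 + (size G).-1)%N.
Proof.
rewrite size_mul //; move: N0 G0; rewrite -!size_poly_gt0.
by case: (size N) => // a; case: (size G) => // b _ _; rewrite addSn addnS.
Qed.

Let q_gt0 k : (0 < #|F| ^ k)%N.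
Proof. by rewrite expn_gt0 (ltn_trans _ (finNzRing_gt1 F)). Qed.

Let sB : {morph s : v w / v - w}.
Proof. by case: actP => _ _ _; apply. Qed.

Let d_gt0 : (0 < d)%N. Proof. by have [] := nu_lengthP N0 k0_gt0 dvdNf. Qed.
Let Nfd : N %| f ^+ d. Proof. by have [] := nu_lengthP N0 k0_gt0 dvdNf. Qed.

Let im_exprE i : im_iter (act (f ^+ i)) 1 = im_iter s i.
Proof. by apply: eq_imset => v; rewrite /= -(act_iter actP). Qed.

(** The first factor is the size of the kernel of [f ^+ i]: its gcd with [N * G] is the gcd with
    [N], since [G] is coprime to [f]. *)
Lemma card_im_iter_act i :
  (#|F| ^ (size (gcdp N (f ^+ i))).-1 * #|im_iter s i| = #|V|)%N.
Proof.
rewrite -(card_act_ker_im actP (f ^+ i)) im_exprE; congr (_ * _)%N.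
rewrite (card_act_ker_gcd actP m_neq0 act_m cardV card_ker_le); congr (_ ^ _.-1)%N.
have cof : coprimep (f ^+ i) G by rewrite coprimep_expl // coprimep_sym.
by rewrite (eqp_size (gcdpC N _)) -(eqp_size (Gauss_gcdpl N cof)).
Qed.

(** From exponent [d] on, the gcd of [N] with the power of [f] is [N] itself. *)
Let im_stable : #|im_iter s d.+1| = #|im_iter s d|.
Proof.
have gcdN i : N %| f ^+ i -> gcdp N (f ^+ i) %= N.
  by move=> Ni; rewrite /eqp dvdp_gcdl dvdp_gcd dvdpp.
have := card_im_iter_act d.+1; rewrite -(card_im_iter_act d).
rewrite (eqp_size (gcdN d _)) ?(eqp_size (gcdN d.+1 _)) //; last first.
  by rewrite exprS dvdp_mull.
by move/eqP; rewrite (eqn_pmul2l (q_gt0 _)) => /eqP.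
Qed.

(** Both sides measure the ratio of the sizes of two consecutive images. *)
Let nu_seriesE : nu_series N f = mkseq (card_ker_im s) d.
Proof.
apply: (@eq_from_nth _ 0%N); rewrite size_map size_nu_gcds ?size_mkseq // => i lt_i.
rewrite (nth_map 0) ?size_nu_gcds // nth_mkseq //.
have := card_im_iter_act i.+1; rewrite -(card_im_iter_act i).
rewrite (card_im_iterS sB i) (deg_gcdp_exprS _ N0 lt_i) expnD -mulnA.
move/eqP; rewrite (eqn_pmul2l (q_gt0 _)) eqn_pmul2r; first by move/eqP.
by rewrite card_gt0; apply/set0Pn; exists (iter i.+1 s 0); rewrite imset_f.
Qed.

(** [G * f ^+ d] is a multiple of [N * G], which gives one inclusion; the image has at least q^(deg
    G) elements, the size of the kernel of [G], which gives equality. *)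
Let stable_ker : im_iter s d = act_ker act G.
Proof.
apply/eqP; rewrite eqEcard; apply/andP; split.
  apply/subsetP=> _ /imsetP[v _ ->]; rewrite inE (act_iter actP).
  have [_ _ actM _] := actP; rewrite -actM -(divpK Nfd) mulrCA -[G * N]mulrC.
  by rewrite actM act_m (act0r actP).
rewrite (card_act_ker actP m_neq0 act_m cardV card_ker_le) ?dvdp_mull //.
rewrite -(leq_pmul2l (q_gt0 (size N).-1)) -expnD -size_m -cardV.
rewrite -(card_im_iter_act d) leq_mul2r; apply/orP; right.
by rewrite leq_exp2l ?finNzRing_gt1 // -!subn1 leq_sub2r // dvdp_leq ?dvdp_gcdl.
Qed.

Let an := annp actP m_neq0 act_m.

Let anP v : v \in im_iter s d -> (an v \is monic) && (an v %| G).
Proof.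
by rewrite stable_ker inE (annpP actP m_neq0 act_m) annp_monic.
Qed.

Let I := {g : {poly F} | (g \is monic) && (g %| G)}.

Let one_I : ((1 : {poly F}) \is monic) && (1 %| G).
Proof. by rewrite monic1 dvd1p. Qed.

(** The annihilator as an index of the final sum. Off the periodic points it does not divide [G],
    and the key is the default 1. *)
Let key v : I := insubd (Sub 1 one_I) (an v).

Let val_key v : v \in im_iter s d -> val (key v) = an v.
Proof. by move=> vP; rewrite val_insubd anP. Qed.

Let iter_id v k : v \in im_iter s d ->
  (iter k s v == v) = (val (key v) %| f ^+ k - 1).
Proof.
move=> vP; rewrite val_key // -(annpP actP m_neq0 act_m).
have [act1 actB _ _] := actP; rewrite actB act1 subr_eq0.
by rewrite (act_iter actP).
Qed.

(** The periodic points form a submodule on which [f] acts injectively, so [p] kills [f v] exactly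
    when it kills [v]. *)
Let annp_s v : v \in im_iter s d -> an (s v) = an v.
Proof.
move=> vP; apply: annp_eq; first exact: annp_monic.
move=> p; rewrite -(annpP actP m_neq0 act_m).
have [_ _ actM _] := actP; rewrite -actM mulrC actM.
have pv : act p v \in im_iter s d.
  move: vP; rewrite stable_ker !inE -!actM => /eqP Gv.
  by rewrite mulrC actM Gv (act0r actP).
have p0 : 0 \in im_iter s d by rewrite stable_ker inE (act0r actP).
rewrite -(inj_in_eq (stable_inj im_stable) pv p0) /s.
by rewrite (act0r actP).
Qed.

Let ord_modP v : v \in im_iter s d ->
  [/\ (0 < ord_mod f (val (key v)))%N,
      iter (ord_mod f (val (key v))) s v = v
    & forall k, (0 < k)%N -> iter k s v = v -> (ord_mod f (val (key v)) <= k)%N].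
Proof.
move=> vP.
have [|/andP[o_gt0 o_dvd] o_min] := @leastP
    (fun k => (0 < k)%N && (val (key v) %| f ^+ k - 1)).
  (* The length of the orbit of [v] is an admissible exponent, so [least] does not return its
     default. *)
  exists (order s v); rewrite order_gt0 -iter_id //; apply/eqP.
  apply: (@iter_order_in V s (im_iter s d)) => //.
    by move=> w; apply: stableS.
  exact: stable_inj.
split=> //; first by apply/eqP; rewrite iter_id.
by move=> k k_gt0 /eqP kv; apply: o_min; rewrite k_gt0 -iter_id.
Qed.

Lemma functional_graph_act :
  digraph_iso (functional_graph s)
    (dsum (fun g : I => copies (Phi (val g) %/ ord_mod f (val g))
      (Cyc (ord_mod f (val g)) (elementary_tree (nu_series N f))))).
Proof.
rewrite nu_seriesE.
have PE v : (v \in [pred v | depth s d v == 0%N]) = (v \in im_iter s d).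
  by rewrite inE depth_eq0.
(* An element whose annihilator divides [G] is periodic, so the class of [g] among periodic points
   is its class in all of [V]. *)
have card_class (g : I) :
    Phi (val g) = #|[pred v in [pred v | depth s d v == 0%N] | key v == g]|.
  have /andP[g_mon gG] := valP g.
  rewrite -(card_annp_Phi actP m_neq0 act_m g_mon).
    apply: eq_card => v; rewrite [in RHS]inE /= PE inE.
    have [vP | vP] := boolP (v \in im_iter s d).
      by rewrite -/an -(val_key vP) val_eqE.
    apply/negP=> /eqP ang; case/negP: vP.
    by rewrite stable_ker inE (annpP actP m_neq0 act_m) ang.
  move=> e eg; apply: (card_act_ker actP m_neq0 act_m cardV card_ker_le).
  by rewrite dvdp_mull // (dvdp_trans eg).
under [X in dsum X]funext => g do rewrite card_class.
apply: (@functional_graph_cycles V 0 s (depth s d) _ I key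
  (fun g => ord_mod f (val g)) (depthS im_stable)).
- by move=> v w; rewrite !PE; apply: stable_inj.
- by move=> y; rewrite PE; apply: hangs_elementary_tree.
- move=> v; rewrite PE => vP; apply: val_inj.
  by rewrite !val_key ?annp_s // stableS.
- by move=> v; rewrite PE => /ord_modP[].
- by move=> v; rewrite PE => /ord_modP[].
- by move=> v k; rewrite PE => /ord_modP[_ _]; apply.
Qed.

End PolyActionGraph.

(** * The graph of L_f on the field with q^n elements *)

Theorem theorem4p7 (F : finFieldType) (p : nat) (hp : p \in [pchar F])
    (f : {poly F}) (hf : f != 0)
    (n t u : nat) (hn : n = (p ^ t * u)%N) (hu : ~~ (p %| u)%N)
    (K : fieldExtType F) (hK : \dim {:K} = n) :
  let h := gcdp f ('X^u - 1) in
  let S := ('X^u - 1) %/ h in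
  digraph_iso
    (functional_graph (fun c : K => (map_poly (in_alg K) (Lpoly f)).[c]))
    (dsum (fun g : {g : {poly F} | (g \is monic) && (g %| S ^+ (p ^ t))} =>
       copies (Phi (val g) %/ ord_mod f (val g))
         (Cyc (ord_mod f (val g))
            (elementary_tree (nu_series (h ^+ (p ^ t)) f))))).
Proof.
move=> h S.
have p_pr := pcharf_prime hp.
have pt_gt0 : (0 < p ^ t)%N by rewrite expn_gt0 prime_gt0.
have u_gt0 : (0 < u)%N by rewrite lt0n; apply: contraNneq hu => ->.
have n_gt0 : (0 < n)%N by rewrite hn muln_gt0 pt_gt0.
have hX : h %| 'X^u - 1 by apply: dvdp_gcdr.
have ShE : S * h = 'X^u - 1 by apply: divpK.
(* As p does not divide u, ['X^u - 1] has no repeated factor, so [S] and [h] are coprime; a common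
   factor of [S] and [f] divides [h] and is thus constant. *)
have sepX : separable_poly ('X^u - 1 : {poly F}).
  by apply: separable_Xn_sub_1; rewrite -(dvdn_pcharf hp).
have coSh : coprimep S h by apply: separable_coprime sepX _; rewrite ShE.
have coSf : coprimep S f.
  apply/coprimepP => e eS ef; have /coprimepP := coSh; apply=> //.
  by rewrite dvdp_gcd ef -ShE dvdp_mulr.
(* Raising to the power p^t is additive, so the product is the p^t-th power of ['X^u - 1]. *)
have mE : h ^+ (p ^ t) * S ^+ (p ^ t) = 'X^n - 1.
  have pP : [pchar {poly F}].-nat (p ^ t)%N.
    have hpP : p \in [pchar {poly F}] by rewrite pchar_poly.
    by rewrite (eq_pnat _ (pcharf_eq hpP)) pnatX pnat_id.
  rewrite -exprMn mulrC ShE exprDn_pchar // exprNn_pchar // expr1n.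
  by rewrite -exprM mulnC -hn.
have size_m : size ('X^n - 1 : {poly F}) = n.+1 by rewrite size_XnsubC.
have m_neq0 : 'X^n - 1 != 0 :> {poly F} by rewrite -size_poly_gt0 size_m.
apply: (@functional_graph_act F (finvect_type K) (@Lact F K) (Lact_action K)
  (h ^+ (p ^ t)) (S ^+ (p ^ t)) f _ _ _ _ _ (p ^ t)).
- by rewrite mE.
- by move=> v; rewrite mE; apply: Lact_Xn_sub1.
- by rewrite mE size_m card_finvect hK.
- move=> e; rewrite mE => em; apply: card_Lact_ker.
  by apply: contraTneq em => ->; rewrite dvd0p.
- exact: coprimep_expl.
- by [].
(* The exponent chosen is p^t, since [h] divides [f]. *)
- by rewrite dvdp_exp2r // dvdp_gcdl.
Qed.
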